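(* Let $n\ge 3$ and let $K_n(\rho)=\left[\rho^{|j-k|}\right]_{j,k=1}^n$. Let $K_n(\rho)$ possess the (type-1 or type-2) double eigenvalue $\lambda_c=-n$ when $\rho=\rho_c\in\mathbb{C}$, corresponding to the critical value $t=t_c\in\mathbb{C}$ (as specified in the context). For this $\rho_c$, let $a$ and $b$ be the Puiseux-series parameters defined via $$\lambda(\rho)=\lambda_c\left[1\pm a\epsilon^{1/2}+b\epsilon+O\left(\epsilon^{3/2}\right)\right],\quad \epsilon=\rho-\rho_c\to 0 .$$ Set $s=-1$ in the type-1 case and $s=+1$ in the type-2 case. Then $a$ and $b$ can be found from $$a=i\sqrt{\frac{2}{n}}\left[\frac{\left(t_c+s\,T_n(t_c)\right)\left(1+s\,T_{n-1}(t_c)\right)}{1-t_c^2}\right]^{1/2}$$ (in which the choice of square root is arbitrary) and $$\left[6n(t_c^2-1)\left(t_c+s\,T_n(t_c)\right)\right]b=12t_c^2+5n(n+1)(t_c^2-1)+4(n+1)T_{n-1}^2(t_c)-4(n-2)T_n^2(t_c)+s\,(n+1)(4t_c^2-1)T_{n-1}(t_c)-3s\,(n-7)\,t_c\,T_n(t_c).$$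
   Context: $T_k$ and $U_k$ are the Chebyshev polynomials of the first and second kinds, $T_k(t)=\cos(k\,\mathrm{Arccos}\,t)$ and $U_k(t)=\frac{\sin[(k+1)\mathrm{Arccos}\,t]}{\sin(\mathrm{Arccos}\,t)}$, $t\in\mathbb{C}$; for half-integer $k$ the same formulas define $T_k$ and $U_k$ (the multivaluedness of $\mathrm{Arccos}$ does not affect the ratios below). Each eigenvalue of $K_n(\rho)$ is of type-1 or type-2: type-1 (type-2) eigenvalues are those associated with skew-symmetric (symmetric) eigenvectors, i.e. eigenvectors $(v_0,\dots,v_{n-1})$ with $v_{n-1-j}=-v_j$ (respectively $v_{n-1-j}=v_j$). ''Double eigenvalue'' means an eigenvalue of algebraic multiplicity $2$. Known fact and definition of critical values: for $\rho\in\mathbb{C}\setminus\{-1,0,1\}$ every repeated eigenvalue of $K_n(\rho)$ is a double eigenvalue equal to $-n$. It is of type-1 iff $\rho$ equals a value $\rho_c=\frac{U_{(n-1)/2}(t_c)}{U_{(n-3)/2}(t_c)}$, where $t_c\in\mathbb{C}$ is a zero of the polynomial $q_1(n,t)=\frac{U_{n-1}(t)-n}{t-1}$ ($n=4,6,8,\dots$) or $q_1(n,t)=\frac{U_{n-1}(t)-n}{t^2-1}$ ($n=5,7,9,\dots$). It is of type-2 iff $\rho$ equals a value $\rho_c=\frac{T_{(n+1)/2}(t_c)}{T_{(n-1)/2}(t_c)}$, where $t_c\in\mathbb{C}$ is a zero of the polynomial $q_2(n,t)=\frac{U_{n-1}(t)+n}{t+1}$ ($n=4,6,8,\dots$) or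 $q_2(n,t)=U_{n-1}(t)+n$ ($n=3,5,7,\dots$). The $t_c$ in the claim is the one giving $\rho_c$ in this way, for the type at hand. The function $\lambda(\rho)$ in the Puiseux series denotes the two eigenvalues of $K_n(\rho)$ that coalesce to $-n$ at $\rho_c$ (the two being distinguished by the $\pm$ sign, so $a$ is determined up to sign). *)

(* Defs.v *)
From HB Require Import structures.
From mathcomp Require Import all_boot all_order all_algebra.
From mathcomp Require Import all_classical all_reals all_analysis.
From mathcomp Require Import complex.
From mathcomp Require Import ring lra.

Set Implicit Arguments.
Unset Strict Implicit.
Unset Printing Implicit Defensive.

Import Order.TTheory GRing.Theory Num.Theory.
Import numFieldNormedType.Exports.

Local Open Scope classical_set_scope.
Local Open Scope ring_scope.
Local Open Scope complex_scope.

Section ComplexTrig.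
Variable R : realType.
Implicit Types z w t : R[i].

Definition cexp z : R[i] :=
  (expR (complex.Re z) * cos (complex.Im z)) +i*
  (expR (complex.Re z) * sin (complex.Im z)).

Definition ccos z : R[i] := (cexp ('i%C * z) + cexp (- ('i%C * z))) / 2.
Definition csin z : R[i] :=
  (cexp ('i%C * z) - cexp (- ('i%C * z))) / (2 * 'i%C).

(* One determination of the multivalued inverse cosine; which one is
   irrelevant for the ratios in [critical].  By [ArccosK] below it is a
   determination at every t in C. *)
Definition Arccos t : R[i] := xget 0 [set z | ccos z = t].

(* T_k(t) and U_k(t) for an order k that need not be an integer. *)
Definition trigT (k t : R[i]) : R[i] := ccos (k * Arccos t).
Definition trigU (k t : R[i]) : R[i] :=
  csin ((k + 1) * Arccos t) / csin (Arccos t).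

Lemma cexpD z w : cexp (z + w) = cexp z * cexp w.
Proof.
case: z w => [a b] [c d]; rewrite /cexp /= expRD cosD sinD.
by apply/eqP; rewrite eq_complex /=; apply/andP; split; apply/eqP; ring.
Qed.

Lemma cexp0 : cexp 0 = 1.
Proof. by rewrite /cexp /= expR0 cos0 sin0 mulr1 mulr0. Qed.

Lemma cexpN_mul z : cexp z * cexp (- z) = 1.
Proof. by rewrite -cexpD subrr cexp0. Qed.

Lemma sqr_i : ('i%C : R[i]) ^+ 2 = -1.
Proof. by rewrite sqr_i. Qed.

Lemma i_neq0 : ('i%C : R[i]) != 0.
Proof. by rewrite eq_complex /= oner_eq0 andbF. Qed.

Lemma ccosD z w : ccos (z + w) = ccos z * ccos w - csin z * csin w.
Proof.
rewrite /ccos /csin mulrDr opprD !cexpD.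
have [i2 i0] := (sqr_i, i_neq0).
move: (cexp ('i%C * z)) (cexp ('i%C * w)) => p q.
move: (cexp (- ('i%C * z))) (cexp (- ('i%C * w))) => p' q'.
move: ('i%C : R[i]) i2 i0 => j j2 j0.
have -> : (p - p') / (2 * j) * ((q - q') / (2 * j)) =
          (p - p') * (q - q') / (4 * j ^+ 2) by field.
by rewrite j2; field.
Qed.

Lemma csinD z w : csin (z + w) = csin z * ccos w + ccos z * csin w.
Proof.
rewrite /ccos /csin mulrDr opprD !cexpD; have := i_neq0.
move: (cexp ('i%C * z)) (cexp ('i%C * w)) => p q.
move: (cexp (- ('i%C * z))) (cexp (- ('i%C * w))) => p' q'.
move: ('i%C : R[i]) => j j0.
by field.
Qed.

Lemma ccosN z : ccos (- z) = ccos z.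
Proof. by rewrite /ccos mulrN opprK addrC. Qed.

Lemma csinN z : csin (- z) = - csin z.
Proof. by rewrite /csin mulrN opprK -[RHS]mulNr opprB. Qed.

Lemma ccos0 : ccos 0 = 1.
Proof. by rewrite /ccos mulr0 oppr0 cexp0; field. Qed.

Lemma csin0 : csin 0 = 0.
Proof. by rewrite /csin mulr0 oppr0 subrr mul0r. Qed.

Lemma cexp_surj z : z != 0 -> exists w, cexp w = z.
Proof.
case: z => a b z0.
have n0 : 0 < a ^+ 2 + b ^+ 2.
  rewrite lt_neqAle addr_ge0 ?sqr_ge0 // andbT eq_sym paddr_eq0 ?sqr_ge0 //.
  by rewrite !sqrf_eq0; apply: contra z0; rewrite eq_complex.
pose r := Num.sqrt (a ^+ 2 + b ^+ 2).
have r0 : 0 < r by rewrite sqrtr_gt0.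
have r2 : r ^+ 2 = a ^+ 2 + b ^+ 2 by rewrite sqr_sqrtr // ltW.
pose x := a / r; pose y := b / r.
have xy : x ^+ 2 + y ^+ 2 = 1.
  by rewrite !expr_div_n -mulrDl -r2 divff // expf_neq0 // gt_eqF.
have x1 : -1 <= x <= 1.
  rewrite -ler_norml -(@ler_pXn2r _ 2) ?nnegrE // real_normK ?num_real //.
  by rewrite expr1n -xy lerDl sqr_ge0.
have sy : `|y| = sin (acos x).
  have y2 : 1 - x ^+ 2 = y ^+ 2 by rewrite -xy addrC addKr.
  by rewrite sin_acos // y2 sqrtr_sqr.
pose p := if 0 <= y then acos x else - acos x.
have cp : cos p = x.
  by rewrite /p; case: ifP => _; rewrite ?cosN acosK // in_itv.
have sp : sin p = y.
  rewrite /p; case: ifP => [y0|/negbT]; first by rewrite -sy ger0_norm.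
  by rewrite -ltNge sinN -sy => y0; rewrite ltr0_norm // opprK.
exists (ln r +i* p); rewrite /cexp /= lnK ?posrE // cp sp /x /y.
by rewrite ![r * _]mulrC !divfK ?gt_eqF.
Qed.

Lemma ccos_surj t : exists z, ccos z = t.
Proof.
pose d : R[i] := sqrtC (t ^+ 2 - 1).
have d2 : d ^+ 2 = t ^+ 2 - 1 by rewrite sqrtCK.
have e0 : t + d != 0.
  apply: contraTneq isT => /eqP; rewrite addr_eq0 => /eqP td.
  move: d2; rewrite td sqrrN => /eqP.
  by rewrite -subr_eq0 opprB addrC subrK oner_eq0.
have [w hw] := cexp_surj e0.
exists (- ('i%C * w)).
have iw : 'i%C * - ('i%C * w) = w.
  by rewrite mulrN mulrA -expr2 sqr_i mulN1r opprK.
rewrite /ccos iw.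
have -> : cexp (- w) = t - d.
  apply: (mulfI (x := cexp w)); first by rewrite hw.
  have -> : cexp w * (t - d) = t ^+ 2 - d ^+ 2 by rewrite hw; ring.
  by rewrite cexpN_mul d2; ring.
by rewrite hw; field.
Qed.

Lemma ArccosK t : ccos (Arccos t) = t.
Proof.
have [z hz] := ccos_surj t.
rewrite /Arccos; exact: (xgetI 0 (P := [set z | ccos z = t]) hz).
Qed.

End ComplexTrig.

Section Chebyshev.
Variable R : realType.

Let hcE := (@hornerM R[i], @hornerD R[i], @hornerN R[i], @hornerC R[i],
  @hornerX R[i], @hornerMn R[i]).

Fixpoint chebT (k : nat) : {poly R[i]} :=
  match k with
  | 0 => 1
  | 1 => 'X
  | (k'.+1 as k1).+1 => 2%:P * 'X * chebT k1 - chebT k'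
  end.

Fixpoint chebU (k : nat) : {poly R[i]} :=
  match k with
  | 0 => 1
  | 1 => 2%:P * 'X
  | (k'.+1 as k1).+1 => 2%:P * 'X * chebU k1 - chebU k'
  end.

Lemma chebTE k (t : R[i]) : (chebT k).[t] = trigT k%:R t.
Proof.
rewrite -{1}[t]ArccosK /trigT; move: (Arccos t) => z.
suff : (chebT k).[ccos z] = ccos (k%:R * z) /\
       (chebT k.+1).[ccos z] = ccos (k.+1%:R * z) by case.
elim: k => [|k [IH1 IH2]]; first by rewrite mul0r mul1r ccos0 !hcE.
split=> //; rewrite [chebT _]/= -/(chebT k.+1) !hcE IH1 IH2.
have -> : k.+2%:R * z = k.+1%:R * z + z by rewrite [k.+2%:R]mulrSr mulrDl mul1r.
have -> : k%:R * z = k.+1%:R * z + - z by rewrite mulrSr mulrDl mul1r addrK.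
by rewrite !ccosD ccosN csinN; ring.
Qed.

Lemma chebUE k (z : R[i]) :
  (chebU k).[ccos z] * csin z = csin ((k%:R + 1) * z).
Proof.
suff : (chebU k).[ccos z] * csin z = csin (k.+1%:R * z) /\
       (chebU k.+1).[ccos z] * csin z = csin (k.+2%:R * z).
  by case=> + _; rewrite -natr1.
elim: k => [|k [IH1 IH2]].
  rewrite !hcE; split; first by rewrite !mul1r.
  have -> : 2%:R * z = z + z by ring.
  by rewrite csinD; ring.
split=> //; rewrite [chebU _]/= -/(chebU k.+1) hornerD hornerN mulrBl IH1.
rewrite hornerM -mulrA IH2 !hcE.
have -> : k.+3%:R * z = k.+2%:R * z + z by rewrite [k.+3%:R]mulrSr mulrDl mul1r.
have -> : k.+1%:R * z = k.+2%:R * z + - z.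
  by rewrite [k.+2%:R]mulrSr mulrDl mul1r addrK.
by rewrite !csinD ccosN csinN; ring.
Qed.

Lemma chebU_1 k : (chebU k).[1] = k.+1%:R /\ (chebU k.+1).[1] = k.+2%:R.
Proof.
elim: k => [|k [IH1 IH2]].
  by split; rewrite !hcE ?expr0 ?mul1r ?mulr1 ?expr1 ?mulrN1 ?mulN1r.
split=> //; rewrite [chebU _]/= -/(chebU k.+1) !hcE IH1 IH2; ring.
Qed.

Lemma chebU_N1 k : (chebU k).[-1] = (-1) ^+ k * k.+1%:R /\
  (chebU k.+1).[-1] = (-1) ^+ k.+1 * k.+2%:R.
Proof.
elim: k => [|k [IH1 IH2]].
  by split; rewrite !hcE ?expr0 ?mul1r ?mulr1 ?expr1 ?mulrN1 ?mulN1r.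
split=> //; rewrite [chebU _]/= -/(chebU k.+1) !hcE IH1 IH2 !exprS; ring.
Qed.

(* The divisions are exact for n >= 1: see [q1P] and [q2P]. *)
Definition q1 (n : nat) : {poly R[i]} :=
  (chebU n.-1 - n%:R%:P) %/ (if odd n then 'X^2 - 1 else 'X - 1).

Definition q2 (n : nat) : {poly R[i]} :=
  if odd n then chebU n.-1 + n%:R%:P
  else (chebU n.-1 + n%:R%:P) %/ ('X + 1).

Lemma q1P n : (0 < n)%N ->
  q1 n * (if odd n then 'X^2 - 1 else 'X - 1) = chebU n.-1 - n%:R%:P.
Proof.
case: n => // n _; rewrite /q1 /=; apply: divpK.
have r1 : root (chebU n - n.+1%:R%:P) 1.
  by rewrite rootE !hcE (chebU_1 n).1 subrr.
have d1 : 'X - 1 %| chebU n - n.+1%:R%:P.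
  by rewrite -[X in 'X - X]/(1%:P) dvdp_XsubCl.
case: ifP => on; last exact: d1.
have r2 : root (chebU n - n.+1%:R%:P) (-1).
  rewrite rootE !hcE (chebU_N1 n).1.
  by rewrite -signr_odd (negbTE on) mul1r subrr.
have d2 : 'X + 1 %| chebU n - n.+1%:R%:P.
  have -> : 'X + 1 = 'X - (-1)%:P :> {poly R[i]} by rewrite polyCN opprK.
  by rewrite dvdp_XsubCl.
have -> : 'X^2 - 1 = ('X - 1) * ('X + 1) :> {poly R[i]} by ring.
rewrite Gauss_dvdp; first by rewrite d1 d2.
have -> : 'X + 1 = 'X - (-1)%:P :> {poly R[i]} by rewrite polyCN opprK.
by rewrite coprimep_XsubC2 // -opprD oppr_eq0 pnatr_eq0.
Qed.

Lemma q2P n : (0 < n)%N ->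
  q2 n * (if odd n then 1 else 'X + 1) = chebU n.-1 + n%:R%:P.
Proof.
case: n => // n _; rewrite /q2 /=; case: ifP => on; first by rewrite mulr1.
apply: divpK.
have -> : 'X + 1 = 'X - (-1)%:P :> {poly R[i]} by rewrite polyCN opprK.
rewrite dvdp_XsubCl rootE !hcE (chebU_N1 n).1.
by move/negbFE: on => on; rewrite -signr_odd on mulN1r addNr.
Qed.

End Chebyshev.

Inductive eigtype := type1 | type2.

Definition eigsign (R : realType) (ty : eigtype) : R[i] :=
  match ty with type1 => -1 | type2 => 1 end.

Section KMS.
Variable R : realType.
Implicit Types (n : nat) (ty : eigtype) (rho lam t a b : R[i]).

Definition kms n (rho : R[i]) : 'M[R[i]]_n := \matrix_(j, k) rho ^+ `|j - k|%N.

(* Multiplicity 2 is algebraic; the type is the parity of an eigenvector. *)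
Definition double_eigenvalue ty n (A : 'M[R[i]]_n) lam : Prop :=
  mup lam (char_poly A) = 2%N /\
  exists v : 'cV[R[i]]_n,
    [/\ v != 0, A *m v = lam *: v &
        forall j, v (rev_ord j) 0 = eigsign R ty * v j 0].

Definition critical ty n t rho : Prop :=
  match ty with
  | type1 => root (q1 R n) t /\
      rho = trigU ((n%:R - 1) / 2) t / trigU ((n%:R - 3) / 2) t
  | type2 => root (q2 R n) t /\
      rho = trigT ((n%:R + 1) / 2) t / trigT ((n%:R - 1) / 2) t
  end.

(* lam1 and lam2 are two eigenvalues of K_n(rho), with multiplicity. *)
Definition eigenpair n rho (lam1 lam2 : R[i]) : bool :=
  ('X - lam1%:P) * ('X - lam2%:P) %| char_poly (kms n rho).

(* Puiseux expansion of the two branches of eigenvalues of K_n that meet at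
   lam_c, in terms of a square root eta of eps = rho - rho_c: the branches with
   signs + and - are mu eta and mu (- eta).  When lam_c is a double eigenvalue
   of K_n(rho_c), they are exactly the two eigenvalues that tend to lam_c.
   The type R[i]^o is R[i] with the topology given by its norm. *)
Definition puiseux n (rho_c lam_c a b : R[i]) : Prop :=
  exists mu : R[i] -> R[i],
    (\forall eta \near (0 : R[i]^o),
       eigenpair n (rho_c + (eta : R[i]) ^+ 2)
         (mu eta) (mu (- (eta : R[i])))) /\
    ((fun eta : R[i] => mu eta - lam_c * (1 + a * eta + b * eta ^+ 2))
       : R[i]^o -> R[i]^o)
    =O_ (0 : R[i]^o)
    ((fun eta : R[i] => eta ^+ 3) : R[i]^o -> R[i]^o).

End KMS.

(* Main.v *)
Require Import Defs.
From mathcomp Require Import all_boot all_order all_algebra.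
From mathcomp Require Import all_classical all_reals all_analysis.
From mathcomp Require Import complex ring.

(* Put s = -1 or +1 according to the type, P = t + s T_n(t), Q = 1 + s T_(n-1)(t).
   Then (rho, lambda) = (P / Q, s U_(n-1)(t)) parametrises the eigenvalues of the
   given type, and d rho / dt = (n + s U_(n-1)) / Q vanishes at t_c.  Expand the
   characteristic polynomial as sum g_ij eps^i nu^j at (rho_c, -n): since -n is a
   double root, g_00 = g_01 = 0 and g_02 <> 0.  Substituting the parametrisation
   gives two relations between g_10, g_02, g_11 and g_03 at orders 2 and 3, and
   (eps, nu) = (eta^2, -n (a eta + b eta^2)) solves the characteristic equation
   modulo eta^4 exactly when a and b are as claimed.  Conversely such an
   approximate solution lies within O(eta^3) of an exact root, because a
   polynomial f has a root within deg f * |f(x) / f'(x)| of any x. *)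

Set Implicit Arguments.
Unset Strict Implicit.
Unset Printing Implicit Defensive.

Import Order.TTheory GRing.Theory Num.Theory.
Import numFieldNormedType.Exports.

Local Open Scope classical_set_scope.
Local Open Scope ring_scope.
Local Open Scope complex_scope.

(** Lets a known equation prove a goal whose two sides have the same difference, which leaves an
    identity for [ring]. *)
Lemma eq_by (V : zmodType) (a b c d : V) : c = d -> a - b = c - d -> a = b.
Proof. by move=> -> /eqP; rewrite subrr subr_eq0 => /eqP. Qed.

(** * Orders of vanishing at 0 *)

Section BigO.
Variable K : numFieldType.
Implicit Types (f g eps nu : K -> K) (k : nat).

Definition bigO k f :=
  exists C : K, \forall x \near (0 : K^o), `|f x| <= C * `|x| ^+ k.

Lemma near0_lt (e : K) : 0 < e -> \forall x \near (0 : K^o), `|x| < e.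
Proof.
move=> e0; apply/nbhs_ballP; exists e => //= x.
by rewrite /ball /= sub0r normrN.
Qed.

Lemma near0W (P : K -> Prop) : (forall x, P x) ->
  \forall x \near (0 : K^o), P x.
Proof. exact: (@nearW K^o (nbhs (0 : K^o)) P (nbhs_filter _)). Qed.

Lemma near0S (P Q : K -> Prop) : (forall x, P x -> Q x) ->
  (\forall x \near (0 : K^o), P x) -> \forall x \near (0 : K^o), Q x.
Proof. exact: (@filterS K^o (nbhs (0 : K^o)) (nbhs_filter _) P Q). Qed.

Lemma near0S2 (P Q S : K -> Prop) : (forall x, P x -> Q x -> S x) ->
  (\forall x \near (0 : K^o), P x) -> (\forall x \near (0 : K^o), Q x) ->
  \forall x \near (0 : K^o), S x.
Proof. exact: (@filterS2 K^o (nbhs (0 : K^o)) (nbhs_filter _) P Q S). Qed.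

Lemma near0N (P : K -> Prop) :
  (\forall x \near (0 : K^o), P x) -> \forall x \near (0 : K^o), P (- x).
Proof.
move=> /nbhs_ballP[e /= e0 He]; apply/nbhs_ballP; exists e => //= x.
rewrite /ball /= sub0r normrN => xe; apply: He.
by rewrite /ball /= sub0r opprK.
Qed.

(** The order of [K] is only partial, so [C] cannot be compared with 0 directly; enlarging it to |C|
    + 1 makes it positive. *)
Lemma bigO_gt0 k f : bigO k f ->
  exists2 C : K, 0 < C & \forall x \near (0 : K^o), `|f x| <= C * `|x| ^+ k.
Proof.
move=> [C Cf]; exists (`|C| + 1); first by rewrite ltr_wpDl.
apply: near0S Cf => x Cx; apply: le_trans (_ : `|C| * `|x| ^+ k <= _).
  rewrite -[X in X <= _]normr_id.
  have Cx0 : 0 <= C * `|x| ^+ k by exact: le_trans Cx.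
  by rewrite normr_id (le_trans Cx) // -[leLHS]ger0_norm // normrM normrX normr_id.
by rewrite ler_wpM2r ?exprn_ge0 // lerDl.
Qed.

Lemma bigO1_small f (e : K) : bigO 1 f -> 0 < e ->
  \forall x \near (0 : K^o), `|f x| < e.
Proof.
move=> /bigO_gt0[C C0 Cf] e0; apply: near0S2 Cf (near0_lt (divr_gt0 e0 C0)).
by move=> x Cx; rewrite ltr_pdivlMr // mulrC; apply: le_lt_trans.
Qed.

Lemma bigO_near k f g :
  (\forall x \near (0 : K^o), f x = g x) -> bigO k f -> bigO k g.
Proof.
move=> fg [C Cf]; exists C.
by apply: near0S2 fg Cf => x ->.
Qed.

Lemma bigO_ext k f g : f =1 g -> bigO k f -> bigO k g.
Proof. by move=> fg; apply: bigO_near; apply: near0W => x; exact: fg. Qed.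

Lemma bigOC (c : K) : bigO 0 (fun=> c).
Proof. by exists `|c|; apply: near0W => x; rewrite expr0 mulr1. Qed.

Lemma bigOX k : bigO k (fun x => x ^+ k).
Proof. by exists 1; apply: near0W => x; rewrite normrX mul1r. Qed.

Lemma bigOD k f g : bigO k f -> bigO k g -> bigO k (fun x => f x + g x).
Proof.
move=> [C Cf] [D Dg]; exists (C + D); apply: near0S2 Cf Dg => x Cx Dx.
by rewrite mulrDl; apply: le_trans (ler_normD _ _) (lerD _ _).
Qed.

Lemma bigON k f : bigO k f -> bigO k (fun x => - f x).
Proof. by move=> [C Cf]; exists C; apply: near0S Cf => x; rewrite normrN. Qed.

Lemma bigOM j k f g :
  bigO j f -> bigO k g -> bigO (j + k) (fun x => f x * g x).
Proof.
move=> [C Cf] [D Dg]; exists (C * D); apply: near0S2 Cf Dg => x Cx Dx.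
by rewrite normrM exprD mulrACA ler_pM.
Qed.

Lemma bigO_le j k f : (j <= k)%N -> bigO k f -> bigO j f.
Proof.
move=> jk /bigO_gt0[C C0 Cf]; exists C.
apply: near0S2 Cf (near0_lt ltr01) => x Cx x1; apply: le_trans Cx _.
by rewrite ler_pM2l // ler_wiXn2l // ltW.
Qed.

Lemma bigOZ k (c : K) f : bigO k f -> bigO k (fun x => c * f x).
Proof. exact: (bigOM (bigOC c)). Qed.

(** At a point with 0 < |x| < |c| / C the bound would give |c| <= C |x| < |c|. *)
Lemma bigO_coef0 k (c : K) : bigO k.+1 (fun x => c * x ^+ k) -> c = 0.
Proof.
move=> /bigO_gt0[C C0 Cf]; apply/eqP/negPn/negP => c0.
have d0 : 0 < `|c| / C by rewrite divr_gt0 // normr_gt0.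
have /nbhs_ballP[e /= e0 He] := near0S2 (fun x => @conj _ _) Cf (near0_lt d0).
have x0 : 0 < e / 2 by rewrite divr_gt0.
have [|] := He (e / 2).
  by rewrite /ball /= sub0r normrN gtr0_norm // ltr_pdivrMr // ltr_pMr // ltr1n.
rewrite normrM normrX (gtr0_norm x0) exprS mulrA ler_pM2r ?exprn_gt0 // => cC.
by rewrite ltr_pdivlMr // mulrC => /(le_lt_trans cC); rewrite ltxx.
Qed.

Lemma bigO_horner f (p : {poly K}) : bigO 0 f -> bigO 0 (fun x => p.[f x]).
Proof.
move=> Of; elim/poly_ind: p => [|p c IH].
  by apply: bigO_ext (bigOC 0) => x; rewrite horner0.
apply: bigO_ext (bigOD (bigOM IH Of) (bigOC c)) => x.
by rewrite hornerD hornerM hornerX hornerC.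
Qed.

Lemma bigO_horner2 eps nu (G : {poly {poly K}}) :
  bigO 0 eps -> bigO 0 nu -> bigO 0 (fun x => G.[nu x, eps x]).
Proof.
move=> Oe On; elim/poly_ind: G => [|p c IH].
  by apply: bigO_ext (bigOC 0) => x; rewrite horner0 horner0.
apply: bigO_ext (bigOD (bigOM IH On) (bigO_horner c Oe)) => x.
by rewrite hornerD hornerM hornerX hornerC hornerD hornerM hornerC.
Qed.

Lemma bigO_poly k (p : {poly K}) :
  (forall i, (i < k)%N -> p`_i = 0) -> bigO k (fun x => p.[x]).
Proof.
move=> p0.
have OX : bigO 0 (fun x : K => x) by apply: bigO_le (bigOX 1).
apply: bigO_ext (bigOM (bigO_horner (drop_poly k p) OX) (bigOX k)) => x.
rewrite -[in RHS](poly_take_drop k p) hornerD hornerM hornerXn.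
suff -> : take_poly k p = 0 by rewrite horner0 add0r.
by apply/polyP => i; rewrite coef_take_poly coef0; case: ifP => // /p0.
Qed.

Lemma bigO_inv f (c : K) : c != 0 -> bigO 1 (fun x => f x - c) ->
  (\forall x \near (0 : K^o), f x != 0) /\ bigO 0 (fun x => (f x)^-1).
Proof.
move=> c0 fc; have c2 : 0 < `|c| / 2 by rewrite divr_gt0 // normr_gt0.
have h : \forall x \near (0 : K^o), `|c| / 2 <= `|f x|.
  apply: near0S (bigO1_small fc c2) => x fx.
  rewrite -(lerD2r (`|c| / 2)) -splitr.
  apply: le_trans (_ : `|f x| + `|f x - c| <= _); last by rewrite lerD2l ltW.
  by rewrite distrC -{1}[c](subrK (f x)) addrC ler_normD.
split; first by apply: near0S h => x hx; rewrite -normr_gt0 (lt_le_trans _ hx).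
exists (`|c| / 2)^-1; apply: near0S h => x hx.
by rewrite expr0 mulr1 normfV lef_pV2 // posrE // (lt_le_trans _ hx).
Qed.

(** Once |x| < |c| / (2 C), the O(x^2) error is at most half of |c x|. *)
Lemma bigO_lower f (c : K) : c != 0 ->
  bigO 2 (fun x => f x - c * x) ->
  \forall x \near (0 : K^o), `|c| / 2 * `|x| <= `|f x|.
Proof.
move=> c0 /bigO_gt0[C C0 Cf].
have c2 : 0 < `|c| / (2 * C) by rewrite divr_gt0 ?normr_gt0 // mulr_gt0.
apply: near0S2 Cf (near0_lt c2) => x fx xc.
rewrite -(lerD2r (`|c| / 2 * `|x|)) -mulrDl -splitr -normrM.
apply: le_trans (_ : `|f x| + `|f x - c * x| <= _).
  by rewrite distrC -{1}[c * x](subrK (f x)) addrC ler_normD.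
rewrite lerD2l (le_trans fx) // expr2 mulrA ler_wpM2r //.
rewrite -ler_pdivlMl // mulrC.
by apply: ltW; apply: lt_le_trans xc _; rewrite invfM mulrA.
Qed.

(* A Taylor expansion in which [eps] has weight 2 and [nu] has weight 1. *)
Lemma bigO_taylor eps nu (G : {poly {poly K}}) : bigO 2 eps -> bigO 1 nu ->
  bigO 4 (fun x => G.[nu x, eps x] - (G`_0`_0 + G`_0`_1 * eps x
    + G`_1`_0 * nu x + G`_1`_1 * (eps x * nu x) + G`_2`_0 * nu x ^+ 2
    + G`_3`_0 * nu x ^+ 3)).
Proof.
move=> Oe On.
have Oe0 : bigO 0 eps by apply: bigO_le Oe.
have On0 : bigO 0 nu by apply: bigO_le On.
have On2 := bigOM On On; have On3 := bigOM On2 On; have On4 := bigOM On3 On.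
have OE k (p : {poly K}) f : bigO k f ->
    bigO k (fun x => p.[eps x] * f x).
  by move=> Of; exact: bigOM (bigO_horner p Oe0) Of.
(* The discarded terms are multiples of eps^2, eps^2 nu, eps nu^2, eps nu^3 and nu^4, all of weight
   4 or 5. *)
have H0 := OE _ (drop_poly 2 G`_0) _ (bigOM Oe Oe).
have H1 := OE _ (drop_poly 2 G`_1) _ (bigOM (bigOM Oe Oe) On).
have H2 := OE _ (drop_poly 1 G`_2) _ (bigOM Oe On2).
have H3 := OE _ (drop_poly 1 G`_3) _ (bigOM Oe On3).
have H4 := bigOM (bigO_horner2 (drop_poly 4 G) Oe0 On0) On4.
apply: bigO_ext (bigOD (bigOD (bigOD (bigOD H0 (bigO_le _ H1)) H2) (bigO_le _ H3)) H4) => // x /=.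
have D k (p : {poly K}) : p.[eps x] = (drop_poly k p).[eps x] * eps x ^+ k
    + (take_poly k p).[eps x].
  by rewrite -[in LHS](poly_take_drop k p) hornerD hornerM hornerXn addrC.
have T2 (p : {poly K}) : (take_poly 2 p).[eps x] = p`_0 + p`_1 * eps x.
  rewrite (@horner_coef_wide _ 2) ?size_take_poly // !big_ord_recl big_ord0.
  by rewrite !coef_take_poly /= expr0 expr1 mulr1 addr0.
have T1 (p : {poly K}) : (take_poly 1 p).[eps x] = p`_0.
  rewrite (@horner_coef_wide _ 1) ?size_take_poly // !big_ord_recl big_ord0.
  by rewrite !coef_take_poly /= expr0 mulr1 addr0.
have -> : G.[nu x, eps x] = (drop_poly 4 G).[nu x, eps x] * nu x ^+ 4
    + ((G`_0).[eps x] + (G`_1).[eps x] * nu x + (G`_2).[eps x] * nu x ^+ 2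
    + (G`_3).[eps x] * nu x ^+ 3).
  rewrite -[in LHS](poly_take_drop 4 G) hornerD hornerM hornerXn addrC.
  rewrite hornerD hornerM -polyC_exp hornerC; congr (_ + _).
  rewrite (@horner_coef_wide _ 4 (take_poly 4 G)) ?size_take_poly // !big_ord_recl big_ord0.
  rewrite !coef_take_poly /= !hornerD -!polyC_exp !hornerM !hornerC.
  rewrite expr0 expr1 mulr1 ?horner0; ring.
rewrite (D 2 G`_0) (D 2 G`_1) (D 1 G`_2) (D 1 G`_3) !T2 !T1.
ring.
Qed.

Lemma bigO_poly_inv (p : {poly K}) : p`_0 != 0 ->
  (\forall x \near (0 : K^o), p.[x] != 0) /\ bigO 0 (fun x => p.[x]^-1).
Proof.
move=> p0; apply: (bigO_inv p0).
have H : bigO 1 (fun x => (p - (p`_0)%:P).[x]).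
  by apply: bigO_poly => -[|//] _; rewrite coefB coefC subrr.
by apply: bigO_ext H => x; rewrite hornerD hornerN hornerC.
Qed.

(* The curve [(eps, nu)] is tangent to the vertical axis, so the coefficients of
   [x ^+ 2] and [x ^+ 3] only involve the terms of weight at most 3. *)
Lemma bigO_taylor_curve eps nu (G : {poly {poly K}}) (r2 r3 l1 l2 : K) :
  G`_0`_0 = 0 -> G`_1`_0 = 0 ->
  bigO 4 (fun x => eps x - (r2 * x ^+ 2 + r3 * x ^+ 3)) ->
  bigO 3 (fun x => nu x - (l1 * x + l2 * x ^+ 2)) ->
  bigO 4 (fun x => G.[nu x, eps x] -
    ((G`_2`_0 * l1 ^+ 2 + G`_0`_1 * r2) * x ^+ 2 +
     (2 * G`_2`_0 * l1 * l2 + G`_0`_1 * r3 + G`_1`_1 * r2 * l1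
      + G`_3`_0 * l1 ^+ 3) * x ^+ 3)).
Proof.
move=> g00 g10 Oe On.
have OX2 := bigOX 2; have OX3 := bigOX 3.
have OX1 : bigO 1 (fun x : K => x) by exact: (bigOX 1).
have Oe3 : bigO 3 (fun x => eps x - r2 * x ^+ 2).
  by apply: bigO_ext (bigOD (bigO_le _ Oe) (bigOZ r3 OX3)) => // x; ring.
have Oe2 : bigO 2 eps.
  by apply: bigO_ext (bigOD (bigO_le _ Oe3) (bigOZ r2 OX2)) => // x; ring.
have On2 : bigO 2 (fun x => nu x - l1 * x).
  by apply: bigO_ext (bigOD (bigO_le _ On) (bigOZ l2 OX2)) => // x; ring.
have On1 : bigO 1 nu.
  by apply: bigO_ext (bigOD (bigO_le _ On2) (bigOZ l1 OX1)) => // x; ring.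
have T := bigO_taylor G Oe2 On1.
have H1 := bigOZ (G`_0`_1) Oe.
have H2 := bigOZ (G`_1`_1) (bigOD (bigOM Oe3 On1) (bigOZ r2 (bigOM OX2 On2))).
(* [H3] treats nu^2 - (l1 x + l2 x^2)^2 as a difference of squares, [H4] treats nu^3 - (l1 x)^3 as a
   difference of cubes. *)
have On1' := bigOD On1 (bigOZ l1 OX1).
have On1'' := bigOD On1' (bigOZ l2 (bigO_le (isT : (1 <= 2)%N) OX2)).
have H3 := bigOZ (G`_2`_0) (bigOD (bigOM On On1'') (bigOZ (l2 ^+ 2) (bigOX 4))).
have On3 := bigOD (bigOM On1 On1) (bigOD (bigOZ l1 (bigOM On1 OX1))
  (bigOZ (l1 ^+ 2) (bigOM OX1 OX1))).
have H4 := bigOZ (G`_3`_0) (bigOM On2 On3).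
apply: bigO_ext (bigOD T (bigOD (bigOD H1 (bigO_le _ H2)) (bigOD H3 H4))) => // x /=.
rewrite g00 g10; ring.
Qed.

Lemma bigO_coef23 (c d : K) :
  bigO 4 (fun x => c * x ^+ 2 + d * x ^+ 3) -> c = 0 /\ d = 0.
Proof.
move=> h; have c0 : c = 0.
  apply: (@bigO_coef0 2).
  by apply: bigO_ext (bigOD (bigO_le _ h) (bigON (bigOZ d (bigOX 3)))) => // x; ring.
split=> //; apply: (@bigO_coef0 3); apply: bigO_ext h => x.
by rewrite c0; ring.
Qed.

Lemma taylor_curve_eq0 eps nu (G : {poly {poly K}}) (r2 r3 l1 l2 : K) :
  G`_0`_0 = 0 -> G`_1`_0 = 0 ->
  bigO 4 (fun x => eps x - (r2 * x ^+ 2 + r3 * x ^+ 3)) ->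
  bigO 3 (fun x => nu x - (l1 * x + l2 * x ^+ 2)) ->
  (\forall x \near (0 : K^o), G.[nu x, eps x] = 0) ->
  G`_2`_0 * l1 ^+ 2 + G`_0`_1 * r2 = 0 /\
  2 * G`_2`_0 * l1 * l2 + G`_0`_1 * r3 + G`_1`_1 * r2 * l1
    + G`_3`_0 * l1 ^+ 3 = 0.
Proof.
move=> g00 g10 Oe On zero; apply: bigO_coef23.
apply: bigO_near (bigON (bigO_taylor_curve g00 g10 Oe On)).
by apply: near0S zero => x ->; rewrite sub0r opprK.
Qed.

End BigO.

(* With [p = c * \prod_i ('X - r_i)], the logarithmic derivative of [p] at [x] is
   the sum of the [(x - r_i)^-1], so one of these terms is large. *)
Lemma root_near (K : numClosedFieldType) (p : {poly K}) (x : K) :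
  p^`().[x] != 0 ->
  exists2 r, root p r & `|p^`().[x]| * `|r - x| <= (size p)%:R * `|p.[x]|.
Proof.
have [s ps] := closed_field_poly_normal p.
have [/eqP px0 _|px0 dp0] := boolP (p.[x] == 0).
  by exists x; rewrite ?px0 ?rootE ?px0 // subrr normr0 mulr0 mulr_ge0 ?ler0n.
have c0 : lead_coef p != 0.
  by apply: contraNneq px0 => /eqP; rewrite lead_coef_eq0 => /eqP ->; rewrite horner0.
pose P t := \prod_(z <- t) ('X - z%:P) : {poly K}.
have pP : p = lead_coef p *: P s by [].
have Px : (P s).[x] != 0 by apply: contraNneq px0 => h; rewrite pP hornerZ h mulr0.
have dP t : (P t).[x] != 0 ->
    (P t)^`().[x] = (P t).[x] * \sum_(z <- t) (x - z)^-1.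
  elim: t => [|z t IH]; first by rewrite /P !big_nil derivC horner0 mulr0.
  rewrite /P !big_cons -/(P t) hornerM mulf_eq0 negb_or => /andP[xz /IH dt].
  rewrite derivM derivXsubC mul1r hornerD hornerM dt.
  by move: xz; rewrite hornerXsubC => xz; field.
have sz : size p = (size s).+1 by rewrite pP size_scale // size_prod_XsubC.
have dpx : p^`().[x] = p.[x] * \sum_(z <- s) (x - z)^-1.
  by rewrite pP derivZ !hornerZ dP // mulrA.
have rp z : z \in s -> root p z by move=> zs; rewrite pP rootZ // root_prod_XsubC.
pose A := `|p^`().[x]|; pose B := (size p)%:R * `|p.[x]|.
have A0 : 0 < A by rewrite normr_gt0.
have B0 : 0 < B by rewrite mulr_gt0 ?normr_gt0 // sz ltr0n.
have [/hasP[z zs zB]|/hasPn h] := boolP (has (fun z => A * `|z - x| <= B) s).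
  by exists z => //; exact: rp.
(* If every root violates the bound, each |1 / (x - z)| is at most A / B; there are only [size p] -
   1 roots, so the sum is strictly less than A / |p(x)|. *)
have : A < A; last by rewrite ltxx.
have le z : z \in s -> `|(x - z)^-1| <= A / B.
  move=> zs; have := h z zs; rewrite -real_ltNge ?ger0_real ?mulr_ge0 //; last exact: ltW.
  move=> Bz; have z0 : 0 < `|x - z|.
    by rewrite distrC -(pmulr_rgt0 _ A0) (lt_trans B0).
  by rewrite normfV -[_^-1]mul1r ler_pdivrMr // mulrAC ler_pdivlMr // mul1r distrC ltW.
have sum_le : `|\sum_(z <- s) (x - z)^-1| <= (size s)%:R * (A / B).
  apply: le_trans (ler_norm_sum _ _ _) _.
  rewrite big_seq (le_trans (ler_sum _ le)) // -big_seq.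
  by rewrite big_const_seq count_predT iter_addr addr0 mulr_natl.
rewrite {1}/A dpx normrM.
apply: le_lt_trans (ler_wpM2l (normr_ge0 _) sum_le) _.
have -> : `|p.[x]| * ((size s)%:R * (A / B)) = A * ((size s)%:R / (size p)%:R).
  by rewrite /B; field; rewrite normr_eq0 px0 sz pnatr_eq0.
by rewrite gtr_pMr // ltr_pdivrMr ?mul1r sz ?ltr0n // ltr_nat.
Qed.

(** * Chebyshev polynomials and eigenvectors of Kac-Murdock-Szego matrices *)

Section ChebyshevIdentities.
Variable R : realType.
Notation T k := (chebT R k).
Notation U k := (chebU R k).

(** With 'X = cos x these are the addition formulas for (k+1)x + x; [chebTU_pell] is then cos^2 +
    sin^2 = 1. *)
Lemma chebTU_step k :
  T k.+2 = 'X * T k.+1 - (1 - 'X^2) * U k /\ U k.+1 = 'X * U k + T k.+1.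
Proof.
elim: k => [|k [IHT IHU]]; first by split; rewrite /= !polyCMn //=; ring.
have Tr : T k.+3 = 2%:P * 'X * T k.+2 - T k.+1 by [].
have Ur : U k.+2 = 2%:P * 'X * U k.+1 - U k by [].
split; first by rewrite Tr IHU IHT; ring.
by rewrite Ur IHU IHT; ring.
Qed.

Lemma chebT_pred k : T k = 'X * T k.+1 + (1 - 'X^2) * U k.
Proof.
case: k => [|k]; first by rewrite /=; ring.
by have [-> ->] := chebTU_step k; ring.
Qed.

Lemma chebTU_pell k : T k.+1 ^+ 2 + (1 - 'X^2) * U k ^+ 2 = 1.
Proof.
elim: k => [|k IH]; first by rewrite /=; ring.
by have [-> ->] := chebTU_step k; rewrite -[RHS]IH; ring.
Qed.

Lemma cheb_horner k t :
  (T k).[t] = t * (T k.+1).[t] + (1 - t ^+ 2) * (U k).[t] /\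
  (T k.+1).[t] ^+ 2 = 1 - (1 - t ^+ 2) * (U k).[t] ^+ 2.
Proof.
have hE := (@hornerD R[i], @hornerM R[i], @hornerN R[i], @hornerX R[i],
  @hornerC R[i], @horner_exp R[i]).
split; first by rewrite {1}chebT_pred !hE; ring.
have := congr1 (fun p => p.[t]) (chebTU_pell k); rewrite !hE => pell.
by apply: (addIr ((1 - t ^+ 2) * (U k).[t] ^+ 2)); rewrite subrK -[RHS]pell; ring.
Qed.

Lemma deriv_chebTU k : (T k.+1)^`() = k.+1%:R * U k /\
  ('X^2 - 1) * (U k)^`() = k.+1%:R * T k.+1 - 'X * U k.
Proof.
elim: k => [|k [IHT IHU]].
  by rewrite derivX derivC /=; split; ring.
have [-> ->] := chebTU_step k.
rewrite !(derivD, derivM, derivN, derivB, derivX, derivXn, derivC) IHT.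
split.
  have -> : (1 - 'X^2) * (U k)^`() = 'X * U k - k.+1%:R * T k.+1 :> {poly R[i]}.
    by rewrite -[LHS]opprK -mulNr opprB IHU; ring.
  ring.
have -> : ('X^2 - 1) * (1 * U k + 'X * (U k)^`() + k.+1%:R * U k) =
  ('X^2 - 1) * (k.+2%:R * U k) + 'X * (('X^2 - 1) * (U k)^`()) :> {poly R[i]}.
  by ring.
by rewrite IHU; ring.
Qed.

(** The part of a row left of the diagonal. Entry j of the eigenvector is [w j.+1], while [w 0] and
    [w n.+1] are ghost entries carrying the boundary conditions. The factor is the characteristic
    polynomial of the recurrence at [rho], so the sum telescopes. *)
Lemma kms_left (K : comNzRingType) (rho t : K) (w : nat -> K) :
  w 0 = rho * w 1 -> (forall i, w i.+2 = 2 * t * w i.+1 - w i) ->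
  forall j, (1 - 2 * t * rho + rho ^+ 2) * (\sum_(k < j) rho ^+ (j - k) * w k.+1)
    = rho * (w j - rho * w j.+1).
Proof.
move=> w0 wS; elim=> [|j IH]; first by rewrite big_ord0 w0; ring.
rewrite big_ord_recr /= subSnn.
have -> : \sum_(k < j) rho ^+ (j.+1 - k) * w k.+1 =
    rho * \sum_(k < j) rho ^+ (j - k) * w k.+1.
  rewrite mulr_sumr; apply: eq_bigr => k _.
  by rewrite subSn ?exprS ?mulrA // ltnW.
by rewrite mulrDr mulrCA IH wS; ring.
Qed.

Lemma kms_right (K : comNzRingType) (rho t : K) (w : nat -> K) n :
  (forall i, w i.+2 = 2 * t * w i.+1 - w i) -> w n.+1 = rho * w n ->
  forall m j, (j + m)%N = n ->
  (1 - 2 * t * rho + rho ^+ 2) * (\sum_(k < m) rho ^+ k * w (j + k).+1)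
    = w j.+1 - rho * w j.
Proof.
move=> wS wn; elim=> [|m IH] j jn.
  by move: jn; rewrite addn0 => ->; rewrite big_ord0 wn; ring.
rewrite big_ord_recl /= addn0 mulrDr.
have -> : \sum_(k < m) rho ^+ bump 0 k * w (j + bump 0 k).+1 =
    rho * \sum_(k < m) rho ^+ k * w (j.+1 + k).+1.
  rewrite mulr_sumr; apply: eq_bigr => k _.
  by rewrite /bump /= add1n exprS mulrA addnS.
by rewrite [X in _ + X]mulrCA IH ?addSnnS // wS; ring.
Qed.

Lemma kms_mul (K : comNzRingType) (rho t : K) (w : nat -> K) n (j : 'I_n) :
  w 0 = rho * w 1 -> (forall i, w i.+2 = 2 * t * w i.+1 - w i) ->
  w n.+1 = rho * w n ->
  (1 - 2 * t * rho + rho ^+ 2) * (\sum_(k < n) w k.+1 * rho ^+ `|k - j|%N)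
    = (1 - rho ^+ 2) * w j.+1.
Proof.
move=> w0 wS wn.
have jn : (j <= n)%N by rewrite ltnW.
rewrite -(big_mkord xpredT (fun k => w k.+1 * rho ^+ `|k - j|%N)).
(* The row is split at the diagonal, whose term goes to the right-hand sum. *)
rewrite (@big_cat_nat _ _ _ j) //= mulrDr.
have -> : \sum_(0 <= k < j) w k.+1 * rho ^+ `|k - j|%N =
    \sum_(k < j) rho ^+ (j - k) * w k.+1.
  rewrite big_mkord; apply: eq_bigr => k _.
  by rewrite distnEr 1?mulrC // ltnW.
have -> : \sum_(j <= k < n) w k.+1 * rho ^+ `|k - j|%N =
    \sum_(k < n - j) rho ^+ k * w (j + k).+1.
  rewrite -{1}[nat_of_ord j]add0n big_addn big_mkord; apply: eq_bigr => k _.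
  by rewrite distnEl ?leq_addl // addnK mulrC addnC.
rewrite (kms_left w0 wS) (kms_right wS wn) ?subnKC //.
ring.
Qed.

(** The recurrence and the left boundary condition give the vector w_(j+1) = U_j - rho U_(j-1), with
    U_(-1) = 0 and w_1 = 1; the second hypothesis is the right boundary condition. *)
Lemma kms_secular m (rho t : R[i]) :
  1 - 2 * t * rho + rho ^+ 2 != 0 ->
  (U m.+2).[t] - 2 * rho * (U m.+1).[t] + rho ^+ 2 * (U m).[t] = 0 ->
  root (char_poly (kms m.+2 rho)) ((1 - rho ^+ 2) / (1 - 2 * t * rho + rho ^+ 2)).
Proof.
move=> D0 sec; rewrite -eigenvalue_root_char; apply/eigenvalueP.
pose w i := if i is j.+1 then (U j).[t] - rho * (if j is k.+1 then (U k).[t] else 0)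
            else rho.
have UE k : (U k.+2).[t] = 2 * t * (U k.+1).[t] - (U k).[t].
  by rewrite /= hornerD hornerN !hornerM !hornerX !hornerC.
have w0 : w 0 = rho * w 1 by rewrite /w /= hornerC mulr0 subr0 mulr1.
have wS i : w i.+2 = 2 * t * w i.+1 - w i.
  case: i => [|[|i]].
  - by rewrite /w /= !(hornerC, hornerM, hornerX); ring.
  - by rewrite /w UE /= !(hornerC, hornerM, hornerX); ring.
  - by rewrite /w !UE; ring.
have wn : w m.+3 = rho * w m.+2.
  by apply/eqP; rewrite -subr_eq0 -[X in _ == X]sec /w; apply/eqP; ring.
exists (\row_j w j.+1).
  apply/rowP => j; rewrite !mxE.
  apply: (mulfI D0); rewrite mulrA [_ * (_ / _)]mulrC divfK // -(kms_mul j w0 wS wn).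
  by congr (_ * _); apply: eq_bigr => k _; rewrite !mxE.
apply/eqP => /rowP/(_ ord0); rewrite !mxE /w /= hornerC mulr0 subr0.
by move/eqP; rewrite oner_eq0.
Qed.

(* Since [rho = (t + s T_n) / (1 + s T_(n-1))] one has
   [1 - 2 t rho + rho^2 = 2 (1 - t^2) / (1 + s T_(n-1))]. *)
Lemma kms_param m (s t : R[i]) : s ^+ 2 = 1 -> t ^+ 2 != 1 ->
  1 + s * (T m.+1).[t] != 0 ->
  root (char_poly (kms m.+2 ((t + s * (T m.+2).[t]) / (1 + s * (T m.+1).[t]))))
    (s * (U m.+1).[t]).
Proof.
move=> s1 t1.
have t1' : 1 - t ^+ 2 != 0 by rewrite subr_eq0 eq_sym.
have [_ U2] := chebTU_step m.+1.
have U2' : (U m.+2).[t] = t * (U m.+1).[t] + (T m.+2).[t].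
  by rewrite U2 hornerD hornerM hornerX.
have U0 : (U m).[t] = t * (U m.+1).[t] - (T m.+2).[t].
  have -> : U m = 2%:P * 'X * U m.+1 - U m.+2.
    by have -> : U m.+2 = 2%:P * 'X * U m.+1 - U m by []; ring.
  by rewrite hornerD hornerN !hornerM !hornerX !hornerC U2'; ring.
have := @kms_secular m ((t + s * (T m.+2).[t]) / (1 + s * (T m.+1).[t])) t.
have [] := cheb_horner m.+1 t.
rewrite U2' U0.
move: (T m.+2).[t] (U m.+1).[t] (T m.+1).[t] => c u d dE pell sec Q0.
set rho := (t + s * c) / (1 + s * d) in sec *.
have DQ : (1 - 2 * t * rho + rho ^+ 2) * (1 + s * d) = 2 * (1 - t ^+ 2).
  apply: (mulIf Q0).
  rewrite /rho; transitivity ((1 + s * d) ^+ 2 - 2 * t * (t + s * c) * (1 + s * d)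
     + (t + s * c) ^+ 2); first by field.
  rewrite dE; ring: s1 pell.
have D0 : 1 - 2 * t * rho + rho ^+ 2 != 0.
  apply: contraNneq t1' => D0; move: DQ; rewrite D0 mul0r => /esym/eqP.
  by rewrite mulf_eq0 pnatr_eq0.
have -> : s * u = (1 - rho ^+ 2) / (1 - 2 * t * rho + rho ^+ 2).
  apply: (mulIf D0); rewrite divfK //; apply: (mulIf Q0).
  rewrite -mulrA DQ; apply: (mulIf Q0).
  transitivity ((1 + s * d) ^+ 2 - (t + s * c) ^+ 2); last by rewrite /rho; field.
  rewrite dE; ring: s1 pell.
apply: sec => //; apply: (mulIf Q0); apply: (mulIf Q0); rewrite !mul0r.
transitivity ((1 + s * d) ^+ 2 * (t * u + c) - 2 * (1 + s * d) * (t + s * c) * u +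
  (t + s * c) ^+ 2 * (t * u - c)); first by rewrite /rho; field.
rewrite dE; ring: s1 pell.
Qed.
End ChebyshevIdentities.

(* [p / q] has derivative [d / q], and [d] vanishes at [0]. *)
Lemma bigO_ratio (K : numFieldType) (p q d : {poly K}) :
  p^`() * q - p * q^`() = d * q -> d`_0 = 0 -> q`_0 != 0 ->
  bigO 4 (fun x => p.[x] / q.[x] - p`_0 / q`_0 -
    (d`_1 / (2 * q`_0) * x ^+ 2 +
     (d`_2 / (3 * q`_0) - d`_1 * q`_1 / (3 * q`_0 ^+ 2)) * x ^+ 3)).
Proof.
move=> W d0 q0.
set r := p`_0 / q`_0; set r2 := d`_1 / _; set r3 := _ - _ / _.
(* The coefficients of degree 0, 1 and 2 of the identity determine those of [p] of degree 1, 2 and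
   3. *)
have W0 := congr1 (fun p : {poly K} => p`_0) W.
have W1 := congr1 (fun p : {poly K} => p`_1) W.
have W2 := congr1 (fun p : {poly K} => p`_2) W.
move: W0 W1 W2; rewrite !coefB !coefM !big_ord_recl !big_ord0 /= !coef_deriv /=.
rewrite /bump /= ?addn0 ?add1n ?subSS ?subn0 d0 => W0 W1 W2.
have P1 : p`_1 = p`_0 * q`_1 / q`_0.
  by apply: (mulIf q0); rewrite divfK //; apply: (eq_by W0); ring.
have P2 : p`_2 = (2 * p`_0 * q`_2 + d`_1 * q`_0) / (2 * q`_0).
  apply: (mulfI (_ : 2 * q`_0 != 0)); first by rewrite mulf_neq0 ?pnatr_eq0.
  rewrite [RHS]mulrC divfK ?mulf_neq0 ?pnatr_eq0 //; apply: (eq_by W1); ring.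
have P3 : p`_3 = (3 * p`_0 * q`_3 + p`_1 * q`_2 - p`_2 * q`_1 + d`_1 * q`_1
    + d`_2 * q`_0) / (3 * q`_0).
  apply: (mulfI (_ : 3 * q`_0 != 0)); first by rewrite mulf_neq0 ?pnatr_eq0.
  rewrite [RHS]mulrC divfK ?mulf_neq0 ?pnatr_eq0 //; apply: (eq_by W2); ring.
(* Denominators are cleared: [h] is [q] times the error, and 1 / [q] is bounded near 0. *)
pose h : {poly K} := p - q * (r%:P + r2 *: 'X^2 + r3 *: 'X^3).
have [qn0 qi] := bigO_poly_inv q0.
have Oh : bigO 4 (fun x => h.[x]).
  apply: bigO_poly => i i4; rewrite /h coefB coefM.
  move: i i4 => [|[|[|[|//]]]] _; rewrite !big_ord_recl !big_ord0 /=
    /bump /= !coefD !coefC !coefZ !coefXn /= ?addn0 ?add1n ?P3 ?P2 ?P1 /r2 /r3 /r;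
    by field; rewrite ?pnatr_eq0.
apply: bigO_near (bigOM qi Oh).
apply: near0S qn0 => x qx.
rewrite /h hornerD hornerN hornerM !hornerD !hornerZ !hornerXn hornerC; field.
exact: qx.
Qed.

(** * The Chebyshev differential equation and critical points *)

Section Critical.
Variable R : realType.
Notation T k := (chebT R k).
Notation U k := (chebU R k).

Let hE := (@hornerD R[i], @hornerM R[i], @hornerN R[i], @hornerX R[i],
  @hornerC R[i], @horner_exp R[i]).

(** The second identity, the Chebyshev differential equation of U_k, is the derivative of the
    first. *)
Lemma chebU_ode k (t : R[i]) :
  (t ^+ 2 - 1) * (U k)^`().[t] = k.+1%:R * (T k.+1).[t] - t * (U k).[t] /\
  (t ^+ 2 - 1) * (U k)^`()^`().[t] + 3 * t * (U k)^`().[t] =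
    (k.+1%:R ^+ 2 - 1) * (U k).[t].
Proof.
have [dT dU] := deriv_chebTU R k.
have := congr1 (fun p => p^`().[t]) dU.
rewrite derivM derivB derivXn derivC derivB !derivM dT -polyC_natr derivC derivX.
rewrite !hE => e; split; last by apply: (eq_by e); ring.
have := congr1 (fun p => p.[t]) dU.
by rewrite -polyC_natr -polyC1 !hE.
Qed.

(** A zero of [q1] or [q2] satisfies U_(n-1) = - s n. If it were 1 or -1, the divisor [d] would
    vanish there too, so U_(n-1)' = 0; the differential equation would then force U_(n-1) = 0. *)
Lemma critical_U ty m (t rho : R[i]) : critical ty m.+2 t rho ->
  t ^+ 2 != 1 /\ eigsign R ty * (U m.+1).[t] = - m.+2%:R.
Proof.
move=> crit.
have [d [q [qt qE Nd]]] : exists d q : {poly R[i]},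
    [/\ root q t, q * d = U m.+1 + (eigsign R ty * m.+2%:R)%:P &
      (t ^+ 2 = 1 -> (U m.+1).[t] = - eigsign R ty * m.+2%:R -> d.[t] = 0)].
  have nN0 : m.+2%:R != - m.+2%:R :> R[i].
    by rewrite -subr_eq0 opprK -natrD pnatr_eq0.
  have [U1 _] := chebU_1 R m.+1; have [UN1 _] := chebU_N1 R m.+1.
  rewrite -signr_odd /= in UN1.
  case: ty crit => -[qt _]; rewrite [eigsign _ _]/=.
  - exists (if odd m.+2 then 'X^2 - 1 else 'X - 1), (q1 R m.+2); split=> //.
      by rewrite q1P // mulN1r polyCN.
    rewrite opprK mul1r => /eqP; rewrite sqrf_eq1 => /orP[]/eqP ->.
      by move=> _; case: ifP => _; rewrite !hornerE ?expr1n subrr.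
    rewrite UN1 /=; case: (odd m) => /=; first by rewrite !hornerE sqrrN expr1n subrr.
    by rewrite expr1 mulN1r => /esym/eqP; rewrite (negbTE nN0).
  - exists (if odd m.+2 then 1 else 'X + 1), (q2 R m.+2); split=> //.
      by rewrite q2P // mul1r.
    rewrite mulN1r => /eqP; rewrite sqrf_eq1 => /orP[]/eqP ->.
      by rewrite U1 => /eqP; rewrite (negbTE nN0).
    rewrite UN1 /=; case: (odd m) => /=; last by rewrite !hornerE addNr.
    by rewrite expr0 mul1r => /eqP; rewrite (negbTE nN0).
have Ut : (U m.+1).[t] = - eigsign R ty * m.+2%:R.
  have := congr1 (fun p => p.[t]) qE; rewrite !hE (rootP qt) mul0r => e.
  by apply: (eq_by (esym e)); ring.
have s2 : eigsign R ty ^+ 2 = 1 by case: ty {crit qE Nd Ut} => /=; ring.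
split; last by rewrite Ut mulrA mulrN -expr2 s2 mulN1r.
apply/eqP => t1.
have : (U m.+1)^`().[t] = 0.
  have := congr1 (fun p => p^`().[t]) qE.
  by rewrite derivM derivD derivC addr0 !hE (Nd t1 Ut) (rootP qt) => <-; ring.
move=> dU; have [_] := chebU_ode m.+1 t.
rewrite dU t1 subrr mul0r add0r Ut mulr0 => /esym/eqP.
have -> : (m.+2%:R ^+ 2 - 1) * (- eigsign R ty * m.+2%:R) =
  - (eigsign R ty * (m.+1 * m.+3 * m.+2)%:R) by rewrite !natrM !mulrS; ring.
rewrite oppr_eq0 mulf_eq0 pnatr_eq0 !muln_eq0 orbF => /eqP s0.
by move: s2; rewrite s0 expr0n /= => /eqP; rewrite eq_sym oner_eq0.
Qed.

(** With A = (n+1)x/2 and B = (n-1)x/2 one has t = cos(A-B), T_n = cos(A+B), T_(n-1) = cos 2B. So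
    [rho] is sin A / sin B or cos A / cos B, and the new form multiplies both parts by 2 sin B or 2
    cos B. *)
Lemma critical_rho ty m (t rho : R[i]) : rho != 0 -> critical ty m.+2 t rho ->
  1 + eigsign R ty * (T m.+1).[t] != 0 /\
  rho = (t + eigsign R ty * (T m.+2).[t]) / (1 + eigsign R ty * (T m.+1).[t]).
Proof.
move=> rho0 crit.
pose x := Arccos t.
have tE : t = ccos x by rewrite /x ArccosK.
pose A := (m.+3%:R / 2) * x; pose B := (m.+1%:R / 2) * x.
have xE : x = A - B by rewrite /A /B !mulrS; field.
have nE : m.+2%:R * x = A + B by rewrite /A /B !mulrS; field.
have pE : m.+1%:R * x = B + B by rewrite /B !mulrS; field.
have A1 : (m.+2%:R - 1) / 2 + 1 = m.+3%:R / 2 :> R[i] by rewrite !mulrS; field.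
have B1 : (m.+2%:R - 3) / 2 + 1 = m.+1%:R / 2 :> R[i] by rewrite !mulrS; field.
have A2 : (m.+2%:R + 1) / 2 = m.+3%:R / 2 :> R[i] by rewrite !mulrS; field.
have B2 : (m.+2%:R - 1) / 2 = m.+1%:R / 2 :> R[i] by rewrite !mulrS; field.
have py z : ccos z ^+ 2 + csin z ^+ 2 = 1 :> R[i].
  by rewrite -(@ccos0 R) -(subrr z) ccosD ccosN csinN; ring.
have Tn : (T m.+2).[t] = ccos A * ccos B - csin A * csin B.
  by rewrite chebTE /trigT -/x nE ccosD.
have Tp : (T m.+1).[t] = ccos B * ccos B - csin B * csin B.
  by rewrite chebTE /trigT -/x pE ccosD.
have tAB : t = ccos A * ccos B + csin A * csin B.
  by rewrite tE xE ccosD ccosN csinN; ring.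
rewrite Tn Tp; rewrite {1}tAB; case: ty crit => -[_ rE]; rewrite [eigsign _ _]/=.
- have {}rE : rho = csin A / csin x / (csin B / csin x).
    by rewrite rE /trigU -/x A1 B1.
  (* Division by zero yields 0, so [rho0] makes the denominators nonzero. *)
  have x0 : csin x != 0 by apply: contraNneq rho0 => h; rewrite rE h invr0 !mulr0 mul0r.
  have B0 : csin B != 0 by apply: contraNneq rho0 => h; rewrite rE h mul0r invr0 mulr0.
  have e : 1 + -1 * (ccos B * ccos B - csin B * csin B) = 2 * csin B ^+ 2.
    by apply: (eq_by (esym (py B))); ring.
  rewrite e mulf_neq0 ?pnatr_eq0 ?expf_neq0 //; split=> //.
  by rewrite rE; field; rewrite ?x0 ?B0.
- have {}rE : rho = ccos A / ccos B.
    by rewrite rE /trigT -/x A2 B2.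
  have B0 : ccos B != 0 by apply: contraNneq rho0 => h; rewrite rE h invr0 mulr0.
  have e : 1 + 1 * (ccos B * ccos B - csin B * csin B) = 2 * ccos B ^+ 2.
    by apply: (eq_by (esym (py B))); ring.
  rewrite e mulf_neq0 ?pnatr_eq0 ?expf_neq0 //; split=> //.
  by rewrite rE; field; rewrite ?B0.
Qed.

End Critical.

(** * Puiseux branches at a double eigenvalue *)

Section CharPoly.
Variable R : realType.
Implicit Types (n : nat) (r l a b : R[i]).

(* The characteristic polynomial of [kms n] recentred at [(r, l)], in the
   eigenvalue (outer variable) and the parameter rho (inner variable). *)
Definition kms_char n r l : {poly {poly R[i]}} :=
  char_poly (\matrix_(j < n, k < n) ('X + r%:P) ^+ `|j - k|%N) \Po ('X + l%:P%:P).

Lemma kms_char_map n r l e :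
  map_poly (horner_eval e) (kms_char n r l) =
  char_poly (kms n (r + e)) \Po ('X + l%:P).
Proof.
rewrite /kms_char map_comp_poly map_char_poly rmorphD /= map_polyX map_polyC /=.
rewrite /horner_eval hornerC; congr (char_poly _ \Po _).
apply/matrixP => j k; rewrite !mxE /horner_eval horner_exp hornerD hornerX hornerC.
by rewrite [e + r]addrC.
Qed.

Lemma kms_char_horner n r l x e :
  (kms_char n r l).[x, e] = (char_poly (kms n (r + e))).[l + x].
Proof.
have := horner_map (horner_eval e) (kms_char n r l) x%:P.
rewrite /= kms_char_map /horner_eval hornerC horner_comp !hornerD hornerX hornerC => <-.
by rewrite [l + x]addrC.
Qed.

Lemma deriv_kms_char_horner n r l x e :
  (kms_char n r l)^`().[x, e] = (char_poly (kms n (r + e)))^`().[l + x].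
Proof.
have := horner_map (horner_eval e) (kms_char n r l)^`() x%:P.
rewrite /= -deriv_map kms_char_map deriv_comp derivD derivX derivC addr0 mulr1.
rewrite /horner_eval hornerC horner_comp !hornerD hornerX hornerC => <-.
by rewrite [l + x]addrC.
Qed.

Lemma kms_char_coef n r l j :
  (kms_char n r l)`_j`_0 = (char_poly (kms n r) \Po ('X + l%:P))`_j.
Proof.
by rewrite -{2}[r]addr0 -kms_char_map coef_map /= /horner_eval horner_coef0.
Qed.

(** The outer index is the power of nu and the inner one that of eps, so [g10] and [g20] in the
    proofs below list the power of nu first. *)
Lemma kms_char_double n r l : mup l (char_poly (kms n r)) = 2%N ->
  [/\ (kms_char n r l)`_0`_0 = 0, (kms_char n r l)`_1`_0 = 0 &
      (kms_char n r l)`_2`_0 != 0].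
Proof.
move=> mup2; set p := char_poly _ in mup2.
have p0 : p != 0 by rewrite monic_neq0 // char_poly_monic.
have /dvdpP[q pq] : ('X - l%:P) ^+ 2 %| p by rewrite -mup_geq // mup2.
have sE : p \Po ('X + l%:P) = (q \Po ('X + l%:P)) * 'X^2.
  rewrite pq comp_polyM rmorphXn /= comp_polyB comp_polyX comp_polyC.
  by rewrite addrK.
rewrite !kms_char_coef -/p sE !coefMXn /= subnn; split=> //.
rewrite -horner_coef0 horner_comp hornerD hornerX hornerC add0r.
apply/negP => ql.
have : ('X - l%:P) ^+ 3 %| p.
  have /dvdpP[q' qE] : 'X - l%:P %| q by rewrite dvdp_XsubCl.
  by rewrite pq qE (exprS _ 2) dvdp_mul // dvdp_mull.
by rewrite -mup_geq // mup2.
Qed.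

(* The two order conditions say that [x |-> (x ^+ 2, l (a x + b x ^+ 2))] solves
   the characteristic equation modulo [x ^+ 4]. *)
Lemma puiseux_coefs n r l a b (G := kms_char n r l) : l != 0 ->
  mup l (char_poly (kms n r)) = 2%N -> G`_0`_1 != 0 ->
  puiseux n r l a b <->
  G`_2`_0 * (l * a) ^+ 2 + G`_0`_1 = 0 /\
  2 * G`_2`_0 * (l * a) * (l * b) + G`_1`_1 * (l * a) + G`_3`_0 * (l * a) ^+ 3 = 0.
Proof.
move=> l0 mup2 g01.
have [g00 g10 g20] := kms_char_double mup2; rewrite -/G in g00 g10 g20.
have OX2 : bigO 4 (fun x : R[i] => x ^+ 2 - (1 * x ^+ 2 + 0 * x ^+ 3)).
  by apply: bigO_ext (bigO_poly (p := 0) _) => [x|i _]; rewrite ?horner0 ?coef0 //; ring.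
split.
  move=> [mu [pair /eqO_exP[C _ HC]]].
  have Omu : bigO 3 (fun x => mu x - l - (l * a * x + l * b * x ^+ 2)).
    exists C; apply: near0S HC => x.
    rewrite normrX; congr (`| _ | <= _); ring.
  have zero : \forall x \near (0 : R[i]^o), G.[mu x - l, x ^+ 2] = 0.
    apply: near0S pair => x; rewrite /eigenpair => dvd.
    rewrite /G kms_char_horner [l + _]addrC subrK; apply/rootP.
    by rewrite -dvdp_XsubCl (dvdp_trans _ dvd) // dvdp_mulr.
  have [] := taylor_curve_eq0 g00 g10 OX2 Omu zero.
  by rewrite !mulr1 mulr0 addr0.
move=> [h2 h3].
have a0 : a != 0.
  by apply: contraNneq g01 => a0; move: h2; rewrite a0 mulr0 expr0n mulr0 add0r => ->.
pose lam0 (x : R[i]) := l * a * x + l * b * x ^+ 2.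
have Olam : bigO 3 (fun x => lam0 x - (l * a * x + l * b * x ^+ 2)).
  by apply: bigO_ext (bigO_poly (p := 0) _) => [x|i _]; rewrite ?horner0 ?coef0 // subrr.
have OG : bigO 4 (fun x => G.[lam0 x, x ^+ 2]).
  apply: bigO_ext (bigO_taylor_curve g00 g10 OX2 Olam) => x.
  have -> : G`_0`_1 * 1 = G`_0`_1 by rewrite mulr1.
  rewrite h2.
  have -> : forall c, c + G`_0`_1 * 0 + G`_1`_1 * 1 * (l * a) + G`_3`_0 * (l * a) ^+ 3
     = c + G`_1`_1 * (l * a) + G`_3`_0 * (l * a) ^+ 3 by move=> c; ring.
  by rewrite h3 !mul0r addr0 subr0.
have Ol1 : bigO 1 lam0.
  have Ob := bigOZ (l * b) (bigO_le (isT : (1 <= 2)%N) (bigOX _ 2)).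
  by apply: bigO_ext (bigOD (bigOZ (l * a) (bigOX _ 1)) Ob) => x.
have Ol2 : bigO 2 (fun x => lam0 x - l * a * x).
  by apply: bigO_ext (bigOZ (l * b) (bigOX _ 2)) => x; rewrite /lam0; ring.
(* The derivative in the eigenvalue is 2 g20 l a x to first order, hence nonzero for small x !=
   0. *)
pose D x := G^`().[lam0 x, x ^+ 2].
have OD : bigO 2 (fun x => D x - 2 * G`_2`_0 * l * a * x).
  have Oe := bigOX R[i] 2.
  have T := bigO_taylor G^`() Oe Ol1.
  rewrite !coef_deriv !coefMn g10 in T.
  have T1 := bigOZ (G`_1`_1) Oe.
  have T2 := bigOZ (2 * G`_2`_1) (bigOM Oe Ol1).
  have T3 := bigOZ (3 * G`_3`_0) (bigOM Ol1 Ol1).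
  have T4 := bigOZ (4 * G`_4`_0) (bigOM (bigOM Ol1 Ol1) Ol1).
  have T5 := bigOZ (2 * G`_2`_0) Ol2.
  apply: bigO_ext (bigOD (bigO_le _ T) (bigOD T1 (bigOD (bigO_le _ T2)
    (bigOD T3 (bigOD (bigO_le _ T4) T5))))) => // x.
  rewrite /D; ring.
have c0 : 2 * G`_2`_0 * l * a != 0 by rewrite !mulf_neq0 ?pnatr_eq0.
have Dlow := bigO_lower c0 OD.
set c := 2 * _ * _ * _ in c0 Dlow; pose p x := char_poly (kms n (r + x ^+ 2)).
(* Pick an exact root near the approximate one; where [D] vanishes the value [l] is a filler. *)
have /choice[mu Hmu] : forall x, exists z, (x = 0 -> z = l) /\
    (x != 0 -> D x != 0 -> root (p x) z /\
       `|D x| * `|z - (l + lam0 x)| <= n.+1%:R * `|G.[lam0 x, x ^+ 2]|).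
  move=> x; have [->|x0] := eqVneq x 0; first by exists l; split.
  have [Dx|Dx] := eqVneq (D x) 0; first by exists l; split=> // /eqP; rewrite (negbTE x0).
  have dp : (p x)^`().[l + lam0 x] != 0 by rewrite -deriv_kms_char_horner.
  have [z rz zB] := root_near dp; exists z; split=> [/eqP|_ _].
    by rewrite (negbTE x0).
  by rewrite /D /G deriv_kms_char_horner kms_char_horner
    -(size_char_poly (kms n (r + x ^+ 2))).
have mu0 : mu 0 = l by apply: (Hmu 0).1.
have lam00 : lam0 0 = 0 by rewrite /lam0 expr0n /= !mulr0 addr0.
(* The distance to the exact root is O(x^4) divided by a quantity of order x. *)
have Omu : bigO 3 (fun x => mu x - (l + lam0 x)).
  have [C C0 CG] := bigO_gt0 OG.
  have c2 : 0 < `|c| / 2 by rewrite divr_gt0 ?normr_gt0.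
  exists (n.+1%:R * C / (`|c| / 2)); apply: near0S2 Dlow CG => x Dx Gx.
  have [->|x0] := eqVneq x 0.
    by rewrite mu0 lam00 addr0 subrr normr0 mulr_ge0 // ?exprn_ge0 // divr_ge0 // ?mulr_ge0 ?ltW.
  have x0' : 0 < `|x| by rewrite normr_gt0.
  have D0 : D x != 0 by rewrite -normr_gt0 (lt_le_trans _ Dx) // mulr_gt0.
  have [_ zB] := (Hmu x).2 x0 D0.
  rewrite -mulrA [_^-1 * _]mulrC mulrA ler_pdivlMr //.
  rewrite -(ler_pM2r x0') -[leLHS]mulrA [leLHS]mulrC.
  apply: le_trans (ler_wpM2r (normr_ge0 _) Dx) _; apply: le_trans zB _.
  have -> : n.+1%:R * C * `|x| ^+ 3 * `|x| = n.+1%:R * (C * `|x| ^+ 4) by ring.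
  by rewrite ler_wpM2l.
have OmuN : bigO 3 (fun x => mu (- x) - (l + lam0 (- x))).
  have [C CG] := Omu; exists C; apply: near0S (near0N CG) => x.
  by rewrite normrN.
have la0 : 2 * (l * a) != 0 by rewrite !mulf_neq0 ?pnatr_eq0.
(* The parameter x^2 is the same at x and -x, and the two roots differ by 2 l a x + O(x^2); being
   distinct, they give coprime linear factors. *)
have Odist : bigO 2 (fun x => mu x - mu (- x) - 2 * (l * a) * x).
  apply: bigO_ext (bigO_le _ (bigOD Omu (bigON OmuN))) => // x.
  by rewrite /lam0; ring.
exists mu; split.
  have near2 := near0S2 (fun x => @conj _ _) Dlow (near0N Dlow).
  apply: near0S2 near2 (bigO_lower la0 Odist) => x [Dx DNx] dx.
  rewrite /eigenpair; have [->|x0] := eqVneq x 0.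
    rewrite oppr0 mu0 expr0n addr0 -expr2 -mup_geq ?mup2 //.
    by rewrite monic_neq0 // char_poly_monic.
  have x0' : 0 < `|x| by rewrite normr_gt0.
  have c2 : 0 < `|c| / 2 by rewrite divr_gt0 ?normr_gt0.
  have D0 : D x != 0 by rewrite -normr_gt0 (lt_le_trans _ Dx) // mulr_gt0.
  have DN0 : D (- x) != 0.
    by rewrite -normr_gt0 (lt_le_trans _ DNx) // normrN mulr_gt0.
  have mu_neq : mu x - mu (- x) != 0.
    by rewrite -normr_gt0 (lt_le_trans _ dx) // mulr_gt0 // divr_gt0 ?normr_gt0.
  have [r1 _] := (Hmu x).2 x0 D0.
  have [|r2 _] := (Hmu (- x)).2 _ DN0; first by rewrite oppr_eq0.
  rewrite /p sqrrN in r1 r2.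
  rewrite Gauss_dvdp ?dvdp_XsubCl ?r1 //; apply: coprimep_XsubC2.
  by rewrite -oppr_eq0 opprB.
apply/eqO_exP; have [C C0 CO] := bigO_gt0 Omu; exists C => //.
apply: near0S CO => x; rewrite normrX; congr (`| _ | <= _).
by rewrite /lam0; ring.
Qed.
End CharPoly.

(* The curve [(r2 x^2 + r3 x^3, l1 x + l2 x^2)] lies on the zero set of [g] up
   to fourth order; reparametrising it by the square root of its first
   coordinate identifies the admissible [A] and [B]. *)
Lemma branch_coefs (F : fieldType) (g20 g01 g11 g30 r2 r3 l1 l2 A B : F) :
  (2 : F) != 0 -> g20 != 0 -> r2 != 0 -> l1 != 0 ->
  g20 * l1 ^+ 2 + g01 * r2 = 0 ->
  2 * g20 * l1 * l2 + g01 * r3 + g11 * r2 * l1 + g30 * l1 ^+ 3 = 0 ->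
  (g20 * A ^+ 2 + g01 = 0 /\ 2 * g20 * A * B + g11 * A + g30 * A ^+ 3 = 0) <->
  (A ^+ 2 * r2 = l1 ^+ 2 /\ 2 * r2 ^+ 2 * B = 2 * r2 * l2 - l1 * r3).
Proof.
move=> two0 g20n r2n l1n e2 e3.
have g01E : g01 = - (g20 * l1 ^+ 2 / r2).
  by apply: (mulIf r2n); rewrite mulNr divfK //; apply: (eq_by e2); ring.
have g11E : g11 = (g20 * l1 ^+ 2 * r3 / r2 - 2 * g20 * l1 * l2 - g30 * l1 ^+ 3) / (r2 * l1).
  apply: (mulIf (mulf_neq0 r2n l1n)); rewrite divfK ?mulf_neq0 //.
  by apply: (eq_by e3); rewrite g01E; field.
have A0 : A ^+ 2 * r2 = l1 ^+ 2 -> A != 0.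
  move=> AE; apply: contraNneq l1n => A0; move: AE.
  by rewrite A0 expr0n mul0r => /esym/eqP; rewrite sqrf_eq0.
(* The terms in [g30] cancel once [g11] is eliminated. *)
have key : A ^+ 2 * r2 = l1 ^+ 2 ->
    2 * g20 * A * B + g11 * A + g30 * A ^+ 3 =
    A * g20 / r2 ^+ 2 * (2 * r2 ^+ 2 * B - (2 * r2 * l2 - l1 * r3)).
  move=> AE.
  have -> : g30 * A ^+ 3 = g30 * A * (l1 ^+ 2 / r2) by rewrite -AE mulfK //; ring.
  by rewrite g11E; field; rewrite r2n l1n.
split=> [[h1 h2]|[h1 h2]].
  have AE : A ^+ 2 * r2 = l1 ^+ 2.
    by apply: (mulfI g20n); apply: (eq_by (congr1 ( *%R^~ r2) h1)); rewrite g01E; field.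
  split=> //; move: h2; rewrite (key AE) => /eqP.
  rewrite !mulf_eq0 invr_eq0 expf_eq0 /= (negbTE r2n) (negbTE g20n) (negbTE (A0 AE)) /=.
  by rewrite subr_eq0 => /eqP.
split; last by rewrite key // h2 subrr mulr0.
have -> : A ^+ 2 = l1 ^+ 2 / r2 by rewrite -h1 mulfK.
by rewrite g01E; field.
Qed.

(* The expansions of [rho = P / Q] and [lambda = - n + l1 x + l2 x^2] at the
   critical point, with [rho' = (n + s U) / Q]. *)
Lemma branch_formulas (F : numFieldType) (n s t c e u l1 l2 q1 a b : F)
  (P := t + s * c) (Q := 1 + s * e) (r2 := l1 / (2 * Q))
  (r3 := l2 / (3 * Q) - l1 * q1 / (3 * Q ^+ 2)) :
  s ^+ 2 = 1 -> s * u = - n -> n != 0 -> n ^+ 2 != 1 -> t ^+ 2 != 1 -> Q != 0 ->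
  e = t * c + (1 - t ^+ 2) * u -> c ^+ 2 = 1 - (1 - t ^+ 2) * u ^+ 2 ->
  (t ^+ 2 - 1) * l1 = s * (n * c - t * u) ->
  (t ^+ 2 - 1) * (2 * l2) + 3 * t * l1 = (n ^+ 2 - 1) * (s * u) ->
  q1 = s * (n - 1) * (t * u - c) ->
  l1 != 0 /\
  ((- n * a) ^+ 2 * r2 = l1 ^+ 2 /\
   2 * r2 ^+ 2 * (- n * b) = 2 * r2 * l2 - l1 * r3 <->
   n * a ^+ 2 = 2 * (P * Q / (t ^+ 2 - 1)) /\
   6 * n * (t ^+ 2 - 1) * P * b =
    12 * t ^+ 2 + 5 * n * (n + 1) * (t ^+ 2 - 1)
    + 4 * (n + 1) * e ^+ 2 - 4 * (n - 2) * c ^+ 2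
    + s * (n + 1) * (4 * t ^+ 2 - 1) * e - 3 * s * (n - 7) * t * c).
Proof.
move=> s1 su n0 n1 t1 Q0 eE cE l1E l2E q1E.
have uE : u = - (s * n) by rewrite -[LHS]mul1r -s1 expr2 -mulrA su mulrN.
have t1' : t ^+ 2 - 1 != 0 by rewrite subr_eq0.
(* P = 0 means T_n = - s t, and the Pell identity becomes (t^2 - 1)(n^2 - 1) = 0. *)
have P0 : P != 0.
  apply/eqP => P0; have cs : c = - (s * t).
    by apply: (mulfI (_ : s != 0)); [rewrite -sqrf_eq0 s1 oner_eq0 |
      apply: (eq_by P0); rewrite /P; ring: s1].
  have : (t ^+ 2 - 1) * (n ^+ 2 - 1) = 0.
    by apply: (eq_by (esym cE)); rewrite cs uE; ring: s1.
  by apply/eqP; rewrite mulf_neq0 // subr_eq0.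
have {}l1E : l1 = n * P / (t ^+ 2 - 1).
  by apply: (mulIf t1'); rewrite divfK // mulrC l1E uE /P; ring: s1.
have l10 : l1 != 0 by rewrite l1E !mulf_neq0 // invr_eq0.
split=> //.
have {}l2E : l2 = (- (n ^+ 2 - 1) * n - 3 * t * l1) / (2 * (t ^+ 2 - 1)).
  apply: (mulIf (mulf_neq0 (_ : (2 : F) != 0) t1')); rewrite ?divfK ?mulf_neq0 ?pnatr_eq0 //.
  by apply: (eq_by l2E); rewrite su; ring.
set rhs := (X in _ * b = X).
have rhsE : rhs = 4 * (Q * ((n ^+ 2 - 1) * (t ^+ 2 - 1) + 3 * t * P)
    - (t ^+ 2 - 1) * P * q1).
  by rewrite /rhs q1E /P /Q eE uE; rewrite uE in cE; ring: s1 cE.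
(* In [E1] and [E2] the difference of the sides of a branch equation is a nonzero multiple of that
   of the claimed formula. *)
have k1 : n * l1 / (2 * Q) != 0.
  by rewrite !mulf_neq0 ?invr_eq0 ?mulf_neq0 ?pnatr_eq0.
have E1 : (- n * a) ^+ 2 * r2 - l1 ^+ 2 =
    n * l1 / (2 * Q) * (n * a ^+ 2 - 2 * (P * Q / (t ^+ 2 - 1))).
  by rewrite /r2 l1E; field; rewrite Q0 t1'.
have k2 : - l1 ^+ 2 / (12 * Q ^+ 2 * (t ^+ 2 - 1) * P) != 0.
  by rewrite mulNr oppr_eq0 !mulf_neq0 ?invr_eq0 ?mulf_neq0 ?expf_neq0 ?pnatr_eq0.
have E2 : 2 * r2 ^+ 2 * (- n * b) - (2 * r2 * l2 - l1 * r3) =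
    - l1 ^+ 2 / (12 * Q ^+ 2 * (t ^+ 2 - 1) * P) *
    (6 * n * (t ^+ 2 - 1) * P * b - rhs).
  rewrite rhsE /r2 /r3 l2E l1E; field.
  by rewrite Q0 t1' P0.
have eqv (x y z w k : F) : k != 0 -> x - y = k * (z - w) -> x = y <-> z = w.
  move=> kn E; split=> h; apply/eqP; rewrite -subr_eq0.
    by rewrite -(mulrI_eq0 _ (mulfI kn)) -E h subrr.
  by rewrite E h subrr mulr0.
have [h1 h1'] := eqv _ _ _ _ _ k1 E1; have [h2 h2'] := eqv _ _ _ _ _ k2 E2.
by split=> -[? ?]; split; auto.
Qed.

(** * Taylor coefficients of the parametrising curve *)

Section Curve.
Variable R : realType.
Notation T k := (chebT R k).
Notation U k := (chebU R k).

Lemma deriv_shift (p : {poly R[i]}) t :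
  (p \Po ('X + t%:P))^`() = p^`() \Po ('X + t%:P).
Proof. by rewrite deriv_comp derivD derivX derivC addr0 mulr1. Qed.

Lemma coef0_shift (p : {poly R[i]}) t : (p \Po ('X + t%:P))`_0 = p.[t].
Proof. by rewrite -horner_coef0 horner_comp hornerD hornerX hornerC add0r. Qed.

Lemma coef1_shift (p : {poly R[i]}) t : (p \Po ('X + t%:P))`_1 = p^`().[t].
Proof. by rewrite -coef0_shift -deriv_shift coef_deriv. Qed.

Lemma coef2_shift (p : {poly R[i]}) t :
  2 * (p \Po ('X + t%:P))`_2 = p^`()^`().[t].
Proof. by rewrite -coef1_shift -deriv_shift coef_deriv mulr_natl. Qed.

(** U_(k-1) is replaced by 'X U_k - T_(k+1), which also covers k = 0. *)
Lemma deriv_chebT k : (T k)^`() = k%:R * ('X * U k - T k.+1).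
Proof.
case: k => [|k]; first by rewrite derivC mul0r.
have [-> ->] := chebTU_step R k.
by rewrite (deriv_chebTU R k).1; ring.
Qed.

(** This is d rho / dt = (n + s U_(n-1)) / Q with denominators cleared, for n = [m.+1]. *)
Lemma cheb_wronskian (s : R[i]) m
  (p := 'X + s%:P * T m.+1) (q := 1 + s%:P * T m)
  (d := m.+1%:R + s%:P * U m) :
  s ^+ 2 = 1 -> p^`() * q - p * q^`() = d * q.
Proof.
move=> s1; have s1' : s%:P ^+ 2 = 1 :> {poly R[i]} by rewrite -polyC_exp s1.
rewrite /p /q !(derivD, derivM, derivX, derivC) (deriv_chebTU R m).1 deriv_chebT.
rewrite /d [T m]chebT_pred.
have pell : T m.+1 ^+ 2 = 1 - (1 - 'X^2) * U m ^+ 2.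
  by apply: (eq_by (chebTU_pell R m)); ring.
by move: (T m.+1) (U m) pell => c u pell; ring: s1' pell.
Qed.

(** [d] has two roles: it is the numerator of d rho / dt and also nu = lambda + n along the
    curve. *)
Lemma curve_coefs k (s t : R[i])
  (p := ('X + s%:P * T k.+1) \Po ('X + t%:P))
  (q := (1 + s%:P * T k) \Po ('X + t%:P))
  (d := (k.+1%:R + s%:P * U k) \Po ('X + t%:P)) :
  [/\ forall x, p.[x] = t + x + s * (T k.+1).[t + x],
      forall x, q.[x] = 1 + s * (T k).[t + x] &
      forall x, d.[x] = k.+1%:R + s * (U k).[t + x]] /\
  [/\ q`_1 = s * k%:R * (t * (U k).[t] - (T k.+1).[t]),
      d`_1 = s * (U k)^`().[t] & 2 * d`_2 = s * (U k)^`()^`().[t]].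
Proof.
have hE := (@hornerD R[i], @hornerM R[i], @hornerN R[i], @hornerX R[i],
  @hornerC R[i]).
split.
  by split=> x; rewrite /p /q /d horner_comp -?polyC1 -?polyC_natr !hE [x + _]addrC.
have dC (c : R[i]) f : (c%:P * f)^`() = c%:P * f^`().
  by rewrite derivM derivC mul0r add0r.
split.
- rewrite coef1_shift derivD derivC add0r dC deriv_chebT -polyC_natr !hE; ring.
- by rewrite coef1_shift derivD -polyC_natr derivC add0r dC !hE.
- by rewrite coef2_shift derivD -polyC_natr derivC add0r !dC !hE.
Qed.

End Curve.

(** * The Puiseux parameters at a critical point *)

Theorem theorem5p1 (R : realType) (n : nat) (ty : eigtype)
    (rho_c t_c : R[i])
    (hn : (3 <= n)%N)
    (hdouble : double_eigenvalue ty (kms n rho_c) (- n%:R))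
    (hcrit : critical ty n t_c rho_c)
    (a b : R[i]) :
  let s := eigsign R ty in
  let T k := (chebT R k).[t_c] in
  puiseux n rho_c (- n%:R) a b <->
  (exists w : R[i],
     w ^+ 2 = (t_c + s * T n) * (1 + s * T n.-1) / (1 - t_c ^+ 2) /\
     a = 'i%C * (Num.sqrt (2 / n%:R : R))%:C * w) /\
  6 * n%:R * (t_c ^+ 2 - 1) * (t_c + s * T n) * b =
    12 * t_c ^+ 2 + 5 * n%:R * (n%:R + 1) * (t_c ^+ 2 - 1)
    + 4 * (n%:R + 1) * T n.-1 ^+ 2 - 4 * (n%:R - 2) * T n ^+ 2
    + s * (n%:R + 1) * (4 * t_c ^+ 2 - 1) * T n.-1
    - 3 * s * (n%:R - 7) * t_c * T n.
Proof.
case: n hn hdouble hcrit => [|[|m]] // _ [mup2 [v [v0 Kv _]]] hcrit s T.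
(* At [rho_c] = 0 the matrix is the identity, whose only eigenvalue is 1. *)
have rho0 : rho_c != 0.
  apply: contraNneq v0 => rho0; move: Kv.
  have -> : kms m.+2 rho_c = 1%:M.
    apply/matrixP => j k; rewrite !mxE rho0 expr0n; congr (nat_of_bool _)%:R.
    by rewrite absz_eq0 subr_eq0 eqz_nat.
  rewrite mul1mx => /eqP; rewrite -subr_eq0 -{1}[v]scale1r -scalerBl.
  by rewrite scaler_eq0 opprK addrC natr1 pnatr_eq0.
have [t1 sU] := critical_U hcrit.
have [Q00 rhoE] := critical_rho rho0 hcrit.
have s1 : s ^+ 2 = 1 by rewrite /s; case: (ty); rewrite /= ?sqrrN expr1n.
rewrite -/s -/(T m.+2) -/(T m.+1) in sU Q00 rhoE.
have n0 : m.+2%:R != 0 :> R[i] by rewrite pnatr_eq0.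
have t1' : t_c ^+ 2 - 1 != 0 by rewrite subr_eq0.
have [_ pell] := cheb_horner m.+1 t_c.
have [ode1 ode2] := chebU_ode m.+1 t_c.
have [[pE qE dE] [q1 d1 d2]] := curve_coefs m.+1 s t_c.
have W := cheb_wronskian m.+1 s1.
have {W} := congr1 (fun f => f \Po ('X + t_c%:P)) W.
rewrite /= rmorphB !rmorphM /= -!deriv_shift.
move: (_ \Po _) (_ \Po _) (_ \Po _) pE qE dE q1 d1 d2 => d q p pE qE dE q1 d1 d2 W.
have [TE _] := cheb_horner m.+1 t_c.
rewrite -/(T _) in TE pell ode1 q1; rewrite -/(T _) in TE.
have p0 : p`_0 = t_c + s * T m.+2 by rewrite -horner_coef0 pE addr0.
have q0 : q`_0 = 1 + s * T m.+1 by rewrite -horner_coef0 qE addr0.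
have d0 : d`_0 = 0 by rewrite -horner_coef0 dE addr0 sU subrr.
have q0n : q`_0 != 0 by rewrite q0.
have ratio := bigO_ratio W d0 q0n.
rewrite p0 q0 -rhoE in ratio.
have dtail : bigO 3 (fun x => d.[x] - (d`_1 * x + d`_2 * x ^+ 2)).
  have H : bigO 3 (fun x => (d - (d`_1 *: 'X + d`_2 *: 'X^2)).[x]).
    apply: bigO_poly => i i3; rewrite !(coefB, coefD, coefZ) coefX coefXn.
    by move: i i3 => [|[|[|//]]] _ /=; rewrite ?d0; ring.
  by apply: bigO_ext H => x; rewrite !(hornerD, hornerN, hornerZ) hornerX hornerXn.
have [g00 g10 g20] := kms_char_double mup2.
(* Here x = t - t_c; [kms_param] applies for small x, as Q and t^2 - 1 stay nonzero. *)
have curve : \forall x \near (0 : R[i]^o),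
    (kms_char m.+2 rho_c (- m.+2%:R)).[d.[x], p.[x] / q.[x] - rho_c] = 0.
  have [qn _] := bigO_poly_inv q0n.
  have [|tn _] := @bigO_poly_inv _ (('X + t_c%:P) ^+ 2 - 1 : {poly R[i]}) _.
    by rewrite -horner_coef0 !hornerE.
  apply: near0S2 qn tn => x qx tx; rewrite kms_char_horner.
  rewrite [rho_c + _]addrC subrK dE addKr pE qE; apply/rootP.
  apply: kms_param; rewrite -?qE //.
  by move: tx; rewrite !hornerE subr_eq0 [x + _]addrC.
have [c2 c3] := taylor_curve_eq0 g00 g10 ratio dtail curve.
have l1E : (t_c ^+ 2 - 1) * d`_1 =
    s * (m.+2%:R * T m.+2 - t_c * (chebU R m.+1).[t_c]).
  by rewrite d1 mulrCA ode1.
have l2E : (t_c ^+ 2 - 1) * (2 * d`_2) + 3 * t_c * d`_1 =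
    (m.+2%:R ^+ 2 - 1) * (s * (chebU R m.+1).[t_c]).
  by rewrite d2 d1 [RHS]mulrCA -ode2; ring.
have q1E : q`_1 = s * (m.+2%:R - 1) * (t_c * (chebU R m.+1).[t_c] - T m.+2).
  by rewrite q1 -[m.+2%:R]natr1 addrK.
have n1 : m.+2%:R ^+ 2 != 1 :> R[i].
  by rewrite -natrX pnatr_eq1 expnS muln_eq1.
have [l10 formulas] := branch_formulas a b s1 sU n0 n1 t1 Q00 TE pell l1E l2E q1E.
have r20 : d`_1 / (2 * (1 + s * T m.+1)) != 0.
  by rewrite mulf_neq0 // invr_eq0 mulf_neq0 ?pnatr_eq0.
(* Otherwise the second-order relation [c2] reduces to g20 l1^2 = 0. *)
have g01 : (kms_char m.+2 rho_c (- m.+2%:R))`_0`_1 != 0.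
  apply: contraNneq g20 => g01; move: c2; rewrite g01 mul0r addr0 => /eqP.
  by rewrite mulf_eq0 expf_eq0 /= (negbTE l10) orbF.
have two0 : (2 : R[i]) != 0 by rewrite pnatr_eq0.
have nn0 : - m.+2%:R != 0 :> R[i] by rewrite oppr_eq0.
rewrite (puiseux_coefs a b nn0 mup2 g01).
rewrite (branch_coefs _ _ two0 g20 r20 l10 c2 c3) formulas.
(* Since j^2 = -2/n, the equation for a^2 amounts to w = a / j; the minus sign turns t_c^2 - 1 into
   1 - t_c^2. *)
have [j j2] : exists j : R[i], j = 'i%C * (Num.sqrt (2 / m.+2%:R : R))%:C /\
    j ^+ 2 = - 2 / m.+2%:R.
  eexists; split; first reflexivity.
  rewrite exprMn sqr_i -rmorphXn /= sqr_sqrtr ?divr_ge0 //.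
  by rewrite mulN1r rmorphM /= fmorphV !rmorph_nat mulNr.
case: j2 => <- j2.
have j0 : j != 0 by rewrite -sqrf_eq0 j2 mulf_neq0 ?oppr_eq0 ?invr_eq0.
have t1n : 1 - t_c ^+ 2 != 0 by rewrite -oppr_eq0 opprB.
suff -> : m.+2%:R * a ^+ 2 = 2 * ((t_c + s * T m.+2) * (1 + s * T m.+1) / (t_c ^+ 2 - 1))
  <-> exists w : R[i],
     w ^+ 2 = (t_c + s * T m.+2) * (1 + s * T m.+1) / (1 - t_c ^+ 2) /\ a = j * w by [].
split=> [aE|[w [wE ->]]].
  exists (a / j); rewrite mulrCA mulfV // mulr1; split=> //.
  rewrite expr_div_n j2; apply: (mulfI two0).
  have -> : a ^+ 2 = 2 * ((t_c + s * T m.+2) * (1 + s * T m.+1) / (t_c ^+ 2 - 1)) / m.+2%:R.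
    by rewrite -aE mulrC mulKf.
  by field; rewrite t1n t1' -natrD add2n n0.
by rewrite exprMn j2 wE; field; rewrite ?t1n ?t1' -natrD add2n n0.
Qed.
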